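(* Let $\lambda$ be an infinite cardinal with $\lambda = \lambda^{<\lambda}$. If $\mathfrak{p}_\lambda = \lambda^+$, then $\mathfrak{t}_\lambda = \lambda^+$.
   Context: $\lambda$ is an infinite cardinal with $\lambda^{<\lambda}=\lambda$, so $\lambda$ is regular. For $A,B\subseteq\lambda$, $A\subseteq^* B$ means $|A\setminus B|<\lambda$. A family $\mathcal{F}\subseteq[\lambda]^\lambda$ has the strong intersection property if $|\bigcap\mathcal{F}'|=\lambda$ for every $\mathcal{F}'\subseteq\mathcal{F}$ with $0<|\mathcal{F}'|<\lambda$. A set $A$ is a pseudointersection of $\mathcal{F}$ if $A\subseteq^* F$ for all $F\in\mathcal{F}$. $\mathfrak{p}_\lambda$ is the least cardinality of a family $\mathcal{F}\subseteq[\lambda]^\lambda$ with the strong intersection property that has no pseudointersection of size $\lambda$. A tower in $\lambda$ is a family $\mathcal{T}\subseteq[\lambda]^\lambda$ that is well ordered by $\supseteq^*$, has the strong intersection property, and has no pseudointersection of size $\lambda$; $\mathfrak{t}_\lambda$ is the least cardinality of a tower in $\lambda$. *)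

(* Defs.v *)
(* Cardinals are represented by types; cardinal comparison
   is via injections. The cardinal lambda is a type T; subsets of lambda are
   predicates T -> Prop; families of subsets are predicates on (T -> Prop). *)
From Stdlib Require Import Classical.

Definition inj (X Y : Type) : Prop :=
  exists f : X -> Y, forall x y, f x = f y -> x = y.

Definition lt_card (X Y : Type) : Prop := inj X Y /\ ~ inj Y X.

Definition is_succ_card (T X : Type) : Prop :=
  lt_card T X /\ forall Y : Type, lt_card T Y -> inj X Y.

Definition infinite_card (T : Type) : Prop := inj nat T.

Definition lt_power_eq (T : Type) : Prop :=
  forall K : Type, lt_card K T -> inj (K -> T) T.

Section Sets.
Variable T : Type.

Definition elts (A : T -> Prop) : Type := { x : T | A x }.

Definition big (A : T -> Prop) : Prop := inj T (elts A).

Definition small (A : T -> Prop) : Prop := ~ inj T (elts A).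

Definition almost_sub (A B : T -> Prop) : Prop :=
  small (fun x => A x /\ ~ B x).

Definition family := (T -> Prop) -> Prop.

Definition fam_elts (F : family) : Type := { A : T -> Prop | F A }.

Definition big_intersection (F : family) : T -> Prop :=
  fun x => forall A, F A -> A x.

Definition in_big_sets (F : family) : Prop := forall A, F A -> big A.

Definition SIP (F : family) : Prop :=
  forall F' : family,
    (forall A, F' A -> F A) ->
    (exists A, F' A) ->
    lt_card (fam_elts F') T ->
    big (big_intersection F').

Definition pseudointersection (F : family) (A : T -> Prop) : Prop :=
  forall B, F B -> almost_sub A B.

Definition has_big_pi (F : family) : Prop :=
  exists A, big A /\ pseudointersection F A.

Definition p_family (F : family) : Prop :=
  in_big_sets F /\ SIP F /\ ~ has_big_pi F.

Definition wo_by_almost_supset (F : family) : Prop :=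
  exists R : fam_elts F -> fam_elts F -> Prop,
    well_founded R /\
    (forall a b c, R a b -> R b c -> R a c) /\
    (forall a b, R a b \/ a = b \/ R b a) /\
    (forall a b, R a b -> almost_sub (proj1_sig b) (proj1_sig a)).

Definition tower (F : family) : Prop :=
  in_big_sets F /\ wo_by_almost_supset F /\ SIP F /\ ~ has_big_pi F.

Definition p_eq_succ : Prop :=
  (forall F, p_family F -> lt_card T (fam_elts F)) /\
  (exists F, p_family F /\ is_succ_card T (fam_elts F)).

Definition t_eq_succ : Prop :=
  (forall F, tower F -> lt_card T (fam_elts F)) /\
  (exists F, tower F /\ is_succ_card T (fam_elts F)).
End Sets.
Arguments p_eq_succ : clear implicits.
Arguments t_eq_succ : clear implicits.

(* Main.v *)
(* A subset of [T] of cardinality [lambda] is an unbounded one, by regularity.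
   Index a family [A] witnessing [p = lambda^+] by a well-order [L] of type
   [lambda^+].  Choose sets [s a c] of size less than [lambda] in [L], coherent
   in that [s a c] is contained in [s b c] for [a < b] and almost all [c], and let
   [f a c >= c] be a point of the intersection of the [A k], [k] in [s a c].  There
   is a decreasing chain [X a] of sets whose gaps dominate the functions [f a].  If
   it has no pseudointersection, it is the tower.  If [C] is a pseudointersection,
   the gaps of [C] dominate all [f a], hence the sets
     [Y a] = union over [c] in [C] of the part of the intersection of the [A k],
     [k] in [s a c], lying between [c] and the next point of [C]
   are unbounded; they form a decreasing chain refining [A], which is the tower.
   A chain of length [lambda^+] has the strong intersection property because
   fewer than [lambda] of its members have a common later one. *)

Require Import Defs.
From Stdlib Require Import Classical ClassicalEpsilon FunctionalExtensionality.
From Stdlib Require Import Wellfounded PeanoNat.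
From mathcomp Require Import ssreflect ssrfun ssrbool eqtype.
From mathcomp Require boolp wochoice.

(** * Choice and injections *)

Lemma fun_choice {A B : Type} (R : A -> B -> Prop) :
  (forall a, exists b, R a b) -> exists f, forall a, R a (f a).
Proof.
move=> H; exists (fun a => proj1_sig (constructive_indefinite_description _ (H a))).
by move=> a; case: constructive_indefinite_description.
Qed.

Lemma inj_trans {X Y Z : Type} : inj X Y -> inj Y Z -> inj X Z.
Proof.
move=> [f Hf] [g Hg]; exists (fun x => g (f x)).
by move=> x y /Hg /Hf.
Qed.

Lemma inj_of_surj {X Y : Type} (f : X -> Y) :
  (forall y, exists x, f x = y) -> inj Y X.
Proof.
move=> /fun_choice [g Hg]; exists g => x y E.
by rewrite -(Hg x) -(Hg y) E.
Qed.

Lemma elts_eq {X : Type} {A : X -> Prop} (u v : elts X A) :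
  proj1_sig u = proj1_sig v -> u = v.
Proof.
case: u v => [u Hu] [v Hv] /= E; subst v.
by rewrite (proof_irrelevance _ Hu Hv).
Qed.

Lemma inj_elts_map {X Y : Type} {A : X -> Prop} {B : Y -> Prop} (h : X -> Y) :
  (forall x y, h x = h y -> x = y) -> (forall x, A x -> B (h x)) ->
  inj (elts X A) (elts Y B).
Proof.
move=> Hh AB.
exists (fun u => exist _ (h (proj1_sig u)) (AB _ (proj2_sig u))).
by move=> u v [] /Hh /elts_eq.
Qed.

Lemma inj_elts_sub {X : Type} {A B : X -> Prop} :
  (forall x, A x -> B x) -> inj (elts X A) (elts X B).
Proof. by move=> AB; apply: (inj_elts_map (fun x => x)). Qed.

(** * Well-orders and transfinite recursion *)

Definition strict_wo {X : Type} (lt : X -> X -> Prop) : Prop :=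
  well_founded lt /\
  (forall a b c, lt a b -> lt b c -> lt a c) /\
  (forall a b, lt a b \/ a = b \/ lt b a).

Lemma wf_irrefl {X : Type} (lt : X -> X -> Prop) :
  well_founded lt -> forall a, ~ lt a a.
Proof. by move=> wf; apply: (well_founded_ind wf) => a IH h; apply: (IH a). Qed.

Lemma wf_least {X : Type} (lt : X -> X -> Prop) (P : X -> Prop) :
  well_founded lt -> (exists x, P x) ->
  exists x, P x /\ forall y, P y -> ~ lt y x.
Proof.
move=> wf; case=> x0; move: x0; apply: (well_founded_ind wf) => x IH Px.
case: (classic (exists y, P y /\ lt y x)) => [[y [Py yx]]|H]; first exact: (IH y).
by exists x; split=> // y Py yx; apply: H; exists y.
Qed.

(** Transfinite recursion with a choice at each stage: [epsilon] picks a value suited to the earlier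
    ones, and induction shows that a pick always exists. *)
Lemma wf_rec_choice {L Q : Type} (lt : L -> L -> Prop) (q0 : Q)
  (P : L -> Q -> Prop) (r : Q -> Q -> Prop) :
  well_founded lt -> (forall a b c, lt a b -> lt b c -> lt a c) ->
  (forall b (g : L -> Q),
     (forall a, lt a b -> P a (g a)) ->
     (forall a a', lt a a' -> lt a' b -> r (g a) (g a')) ->
     exists q, P b q /\ forall a, lt a b -> r (g a) q) ->
  exists g, (forall b, P b (g b)) /\ forall a b, lt a b -> r (g a) (g b).
Proof.
move=> wf tr H.
(* Values are given only below [b]; [rs] makes them a total function with default [q0]. *)
pose rs b (rec : forall a, lt a b -> Q) a : Q :=
  match excluded_middle_informative (lt a b) with
  | left h => rec a h
  | right _ => q0
  end.
pose F b (rec : forall a, lt a b -> Q) : Q :=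
  epsilon (inhabits q0) (fun q => P b q /\ forall a, lt a b -> r (rs b rec a) q).
pose G := Fix wf (fun _ => Q) F.
have GE b : G b = F b (fun a _ => G a).
  rewrite {1}/G Fix_eq // => x f g fg; congr (F x).
  by apply: functional_extensionality_dep => y; apply: functional_extensionality_dep.
have rsE a b : lt a b -> rs b (fun a _ => G a) a = G a.
  by rewrite /rs; case: excluded_middle_informative.
suff K b : P b (G b) /\ forall a, lt a b -> r (G a) (G b).
  by exists G; split=> [b|a b ab]; [case: (K b)|apply: (K b).2].
move: b; apply: (well_founded_ind wf) => b IH.
have [||q [Pq rq]] := H b (rs b (fun a _ => G a)).
- by move=> a ab; rewrite rsE //; apply: (IH a ab).1.
- move=> a a' aa' a'b; rewrite !rsE //; last exact: (tr _ a').
  exact: (IH a' a'b).2.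
- rewrite GE /F.
  have [] := epsilon_spec (inhabits q0) (fun q => P b q /\ forall a, lt a b -> r (rs b (fun a _ => G a) a) q).
    by exists q.
  move=> h1 h2; split=> // a ab.
  by rewrite -{1}(rsE a b ab); apply: h2.
Qed.

(** The strict part of a relation for which every nonempty set has a unique minimum; minima of sets
    of at most three points show that it is an order. *)
Lemma strict_wo_exists (X : Type) : exists lt : X -> X -> Prop, strict_wo lt.
Proof.
pose E : eqType := Equality.Pack (Equality.Class (boolp.gen_eqMixin X)).
have [R wo] := wochoice.well_ordering_principle E.
have least (A : X -> Prop) : (exists x, A x) ->
    exists z, A z /\ (forall x, A x -> R z x) /\
      forall z', A z' -> (forall x, A x -> R z' x) -> z = z'.
  move=> [x Ax]; have [|z [[Az mz] uz]] := wo (fun x => boolp.asbool (A x)).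
    by exists x; apply/boolp.asboolP.
  exists z; split; first exact/boolp.asboolP.
  split=> [y Ay|z' Az' mz']; first by apply: mz; apply/boolp.asboolP.
  by apply: uz; split; [apply/boolp.asboolP|move=> y /boolp.asboolP /mz'].
have total x y : R x y \/ R y x.
  have [|z [[->|->] [h _]]] := least (fun z => z = x \/ z = y).
  - by exists x; left.
  - by left; apply: h; right.
  - by right; apply: h; left.
have refl x : R x x by case: (total x x).
have anti x y : R x y -> R y x -> x = y.
  move=> xy yx; have [|z [_ [_ u]]] := least (fun z => z = x \/ z = y).
    by exists x; left.
  have <- : z = x by apply: u => [|? [] ->]; [left|exact: refl|].
  by apply: u => [|? [] ->]; [right| |exact: refl].
have trans x y z : R x y -> R y z -> R x z.
  move=> xy yz.
  have [|w [h0 [h _]]] := least (fun w => w = x \/ w = y \/ w = z).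
    by exists x; left.
  case: h0 => [Ew|[Ew|Ew]]; subst w.
  - by apply: h; right; right.
  - have Exy : x = y by apply: anti => //; apply: h; left.
    by rewrite Exy.
  - have Eyz : y = z by apply: anti => //; apply: h; right; left.
    by rewrite -Eyz.
exists (fun x y => R x y /\ x <> y); split; [|split].
- move=> x; apply: NNPP => nx.
  have [|z [nz [hz _]]] := least (fun x => ~ Acc (fun x y => R x y /\ x <> y) x).
    by exists x.
  apply: nz; constructor => y [yz Ezy]; apply: NNPP => /hz zy.
  exact/Ezy/anti.
- move=> a b c [ab nab] [bc nbc]; split; first exact: (trans _ b).
  by move=> Eac; subst c; apply/nab/anti.
- move=> a b; case: (classic (a = b)) => [->|nab]; first by right; left.
  by case: (total a b) => h; [left|right; right]; split=> // E'; apply: nab.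
Qed.

(** Distinct values in [Y] are chosen along a well-order of [X]; getting stuck means that the
    earlier values exhaust [Y]. *)
Lemma inj_total (X Y : Type) : inj X Y \/ inj Y X.
Proof.
case: (classic (inj Y X)) => [|nYX]; first by right.
case: (classic (inhabited Y)) => [[y0]|nY]; last first.
  by right; exists (fun y => False_rect _ (nY (inhabits y))) => y; case: nY.
left; have [lt [wf [tr tot]]] := strict_wo_exists X.
have [|g [_ gr]] := wf_rec_choice lt y0 (fun _ _ => True) (fun y y' => y <> y') wf tr.
  move=> b g _ gr; suff [q Hq] : exists q, forall a, lt a b -> g a <> q by exists q.
  apply: NNPP => H; apply: nYX.
  apply: (inj_of_surj g) => y; apply: NNPP => ny.
  by apply: H; exists y => a _ E; apply: ny; exists a.
exists g => x y E; case: (tot x y) => [/gr|[//|/gr]] //.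
by rewrite E.
Qed.

(* If a segment violates [C], embed [X] into the least such segment and pull its order back. *)
Lemma strict_wo_short_segments (X : Type) (C : Type -> Prop) :
  (forall Y Z, inj Y Z -> C Z -> C Y) ->
  (forall Y, ~ C Y -> inj X Y) ->
  exists lt : X -> X -> Prop,
    strict_wo lt /\ forall b, C (elts X (fun a => lt a b)).
Proof.
move=> mono big; have [lt [wf [tr tot]]] := strict_wo_exists X.
case: (classic (exists b, ~ C (elts X (fun a => lt a b)))); last first.
  move=> H; exists lt; split=> // b; apply: NNPP => nC; apply: H; by exists b.
move=> /(wf_least lt _ wf) [b [/big [i inji] Hb]].
exists (fun x y => lt (proj1_sig (i x)) (proj1_sig (i y))).
have inj1 x y : proj1_sig (i x) = proj1_sig (i y) -> x = y.
  by move=> /elts_eq /inji.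
split; first split; [|split|].
- exact: (wf_inverse_image _ _ lt (fun x => proj1_sig (i x)) wf).
- by move=> x y z; apply: tr.
- move=> x y; case: (tot (proj1_sig (i x)) (proj1_sig (i y))) => [|[/inj1|]]; by tauto.
- move=> x; set c := proj1_sig (i x).
  apply: (mono _ (elts X (fun a => lt a c))).
    by apply: (inj_elts_map (fun x => proj1_sig (i x))).
  apply: NNPP => /Hb; apply; exact: (proj2_sig (i x)).
Qed.

(** * Regularity of the cardinal [T] *)

Section RegularCardinal.
Variable T : Type.
Hypothesis T_infinite : infinite_card T.
Hypothesis T_power : lt_power_eq T.

Lemma not_inj_lt_card (K : Type) : ~ inj T K -> lt_card K T.
Proof. by move=> nK; split=> //; case: (inj_total K T). Qed.

Lemma not_inj_bool : ~ inj T bool.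
Proof.
move=> /(inj_trans T_infinite) [h hinj].
have n01 : h 0 <> h 1 by move=> /hinj.
have n02 : h 0 <> h 2 by move=> /hinj.
have n12 : h 1 <> h 2 by move=> /hinj.
by case: (h 0) (h 1) (h 2) n01 n02 n12 => [] [] [].
Qed.

Lemma not_inj_unit : ~ inj T unit.
Proof.
by move=> h; apply: not_inj_bool; apply: (inj_trans h); exists (fun _ => true) => [[] []].
Qed.

(* Koenig's diagonal argument, the functions [K -> T] being indexed by [T]. *)
Lemma small_union (K X : Type) (S : K -> X -> Prop) :
  ~ inj T K -> (forall k, ~ inj T (elts X (S k))) ->
  ~ inj T (elts X (fun x => exists k, S k x)).
Proof.
move=> nK nS [j jinj].
have [phi phiinj] := T_power K (not_inj_lt_card K nK).
(* If every [t] were [u k] for some [u] with [j (phi u)] in [S k], then [T] would inject into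
   [S k]. *)
have H k : exists t : T, forall u : K -> T, S k (proj1_sig (j (phi u))) -> u k <> t.
  apply: NNPP => H; apply: (nS k).
  have H' t : exists u : K -> T, S k (proj1_sig (j (phi u))) /\ u k = t.
    apply: NNPP => nu; apply: H; exists t => u Su E; apply: nu; by exists u.
  have [g gP] := fun_choice _ H'.
  exists (fun t => exist _ (proj1_sig (j (phi (g t)))) (proj1 (gP t))).
  move=> x y [] /elts_eq /jinj /phiinj E.
  by rewrite -(proj2 (gP x)) -(proj2 (gP y)) E.
have [u uP] := fun_choice _ H.
have [k Sk] := proj2_sig (j (phi u)).
exact: (uP k u Sk).
Qed.

(** Pairs are functions on [bool], which is smaller than [T]. *)
Lemma prod_inj : inj (T * T) T.
Proof.
apply: (inj_trans _ (T_power bool (not_inj_lt_card _ not_inj_bool))).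
exists (fun p (b : bool) => if b then p.1 else p.2) => -[a b] [c d] E.
by move: (equal_f E true) (equal_f E false) => /= -> ->.
Qed.

Lemma T_two : exists a b : T, a <> b.
Proof.
have [f finj] := T_infinite; exists (f 0), (f 1) => /finj //.
Qed.

Variable lt : T -> T -> Prop.
Hypothesis lt_wo : strict_wo lt.
Hypothesis lt_seg : forall b, ~ inj T (elts T (fun a => lt a b)).

Lemma lt_trans a b c : lt a b -> lt b c -> lt a c.
Proof. by case: lt_wo => _ [h _]; exact: h. Qed.

Lemma lt_total a b : lt a b \/ a = b \/ lt b a.
Proof. by case: lt_wo => _ [_ h]; exact: h. Qed.

Lemma lt_irrefl a : ~ lt a a.
Proof. by case: lt_wo => h _; exact: wf_irrefl. Qed.

Lemma not_lt a b : ~ lt a b -> b = a \/ lt b a.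
Proof. by case: (lt_total a b) => [|[->|]]; tauto. Qed.

Lemma le_lt_trans a b c : ~ lt b a -> lt b c -> lt a c.
Proof. by move=> /not_lt [->|] //; exact: lt_trans. Qed.

Lemma lt_le_trans a b c : lt a b -> ~ lt c b -> lt a c.
Proof. by move=> ab /not_lt [<-|] //; exact: lt_trans. Qed.

Lemma small_singleton (X : Type) (x : X) : ~ inj T (elts X (fun y => y = x)).
Proof.
move=> h; apply: not_inj_unit; apply: (inj_trans h).
by exists (fun _ => tt) => -[u Hu] [v Hv] _; apply: elts_eq; rewrite /= Hu Hv.
Qed.

Lemma small_or (X : Type) (A B : X -> Prop) :
  ~ inj T (elts X A) -> ~ inj T (elts X B) -> ~ inj T (elts X (fun x => A x \/ B x)).
Proof.
move=> nA nB h.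
apply: (small_union bool X (fun b : bool => if b then A else B) not_inj_bool).
  by case.
apply: (inj_trans h); apply: inj_elts_sub => x [?|?]; [by exists true|by exists false].
Qed.

Lemma small_le_seg b : ~ inj T (elts T (fun a => ~ lt b a)).
Proof.
move=> h; apply: (small_or T (fun a => a = b) (fun a => lt a b)) => //.
  exact: small_singleton.
by apply: (inj_trans h); apply: inj_elts_sub => a /not_lt.
Qed.

(** Regularity: without a bound, fewer than $\lambda$ small initial segments would cover [T]. *)
Lemma small_range_bounded (K : Type) (s : K -> T) :
  ~ inj T K -> exists b, forall k, lt (s k) b.
Proof.
move=> nK; apply: NNPP => H.
apply: (small_union K T (fun k a => ~ lt (s k) a) nK) => [k|].
  exact: small_le_seg.
suff K' a : exists k, ~ lt (s k) a.
  by exists (fun a => exist _ a (K' a)) => x y [].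
by apply: NNPP => nk; apply: H; exists a => k; apply: NNPP => h; apply: nk; exists k.
Qed.

Lemma lt_succ a : exists b, lt a b.
Proof.
have [b Hb] := small_range_bounded unit (fun _ => a) not_inj_unit.
by exists b; apply: Hb tt.
Qed.

Lemma lt_max a b : exists c, lt a c /\ lt b c.
Proof.
have [c Hc] := small_range_bounded bool (fun k : bool => if k then a else b) not_inj_bool.
by exists c; split; [apply: (Hc true)|apply: (Hc false)].
Qed.

(** * Unbounded sets and almost inclusion *)

Definition unbounded (A : T -> Prop) : Prop := forall b, exists a, A a /\ lt b a.

Lemma small_bounded (A : T -> Prop) :
  small T A <-> exists b, forall a, A a -> lt a b.
Proof.
split=> [sA|[b Hb] iA].
  have [b Hb] := small_range_bounded (elts T A) (@proj1_sig _ _) sA.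
  by exists b => a Aa; apply: (Hb (exist _ a Aa)).
by apply: (lt_seg b); apply: (inj_trans iA); apply: inj_elts_sub.
Qed.

Lemma big_unbounded (A : T -> Prop) : big T A <-> unbounded A.
Proof.
split=> [bA b|uA].
  apply: NNPP => H; apply: (proj2 (small_bounded A)) bA.
  have [c bc] := lt_succ b; exists c => a Aa.
  by apply: (le_lt_trans _ _ _ _ bc) => ba; apply: H; exists a.
apply: NNPP => /small_bounded [b Hb].
have [a [/Hb ab ba]] := uA b.
exact: (lt_irrefl a (lt_trans _ _ _ ab ba)).
Qed.

Lemma almost_subE (A B : T -> Prop) :
  almost_sub T A B <-> exists b, forall x, A x -> lt b x -> B x.
Proof.
split=> [/small_bounded [b Hb]|[b Hb]].
  exists b => x Ax bx; apply: NNPP => nB.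
  exact: (lt_irrefl x (lt_trans _ _ _ (Hb x (conj Ax nB)) bx)).
apply/small_bounded; have [c bc] := lt_succ b; exists c => x [Ax nB].
by apply: (le_lt_trans _ _ _ _ bc) => /Hb; tauto.
Qed.

(** By regularity, the points beyond which [Y] lies in each [S k] have a common bound. *)
Lemma almost_sub_big_inter (K : Type) (Y : T -> Prop) (S : K -> T -> Prop) :
  ~ inj T K -> unbounded Y -> (forall k, almost_sub T Y (S k)) ->
  unbounded (fun x => Y x /\ forall k, S k x).
Proof.
move=> nK uY YS.
have [s sP] := fun_choice _ (fun k => proj1 (almost_subE _ _) (YS k)).
have [b Hb] := small_range_bounded K s nK.
move=> c; have [d [bd cd]] := lt_max b c.
have [x [Yx dx]] := uY d; exists x; split; last exact: (lt_trans _ d).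
split=> // k; apply: sP => //.
by apply: (lt_trans _ b) => //; apply: (lt_trans _ d).
Qed.

Lemma inj_on {X Y : Type} (A : X -> Prop) :
  inhabited Y -> inj (elts X A) Y ->
  exists c : X -> Y, forall x y, A x -> A y -> c x = c y -> x = y.
Proof.
move=> [y0] [e einj].
exists (fun x => match excluded_middle_informative (A x) with
  left h => e (exist _ x h) | right _ => y0 end) => x y Ax Ay.
case: excluded_middle_informative => // h; case: excluded_middle_informative => // h'.
by move=> /einj [].
Qed.

Lemma T_inhabited : inhabited T.
Proof. by have [a _] := T_two; constructor. Qed.

(** A point is coded by the index of a set containing it and its code in that set. *)
Lemma union_inj_T (K X : Type) (S : K -> X -> Prop) :
  inj K T -> (forall k, inj (elts X (S k)) T) -> (forall x, exists k, S k x) ->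
  inj X T.
Proof.
move=> [i iinj] Sinj cov; apply: (inj_trans _ prod_inj).
have [c cP] := fun_choice _ (fun k => inj_on (S k) T_inhabited (Sinj k)).
have [t tP] := fun_choice _ cov.
exists (fun x => (i (t x), c (t x) x)) => x y [/iinj E].
by rewrite E; apply: cP => //; rewrite -E.
Qed.

(** * The well-order [L] of type $\lambda^+$ *)

Variable L : Type.
Hypothesis L_succ : is_succ_card T L.
Variable ltL : L -> L -> Prop.
Hypothesis ltL_wo : strict_wo ltL.
Hypothesis ltL_seg : forall b, inj (elts L (fun a => ltL a b)) T.

Lemma ltL_trans a b c : ltL a b -> ltL b c -> ltL a c.
Proof. by case: ltL_wo => _ [h _]; exact: h. Qed.

Lemma ltL_total a b : ltL a b \/ a = b \/ ltL b a.
Proof. by case: ltL_wo => _ [_ h]; exact: h. Qed.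

Lemma ltL_irrefl a : ~ ltL a a.
Proof. by case: ltL_wo => h _; exact: wf_irrefl. Qed.

Lemma inj_le_segL b : inj (elts L (fun a => ~ ltL b a)) T.
Proof.
have [t0 [t1 n01]] := T_two; apply: (inj_trans _ prod_inj).
have [c cP] := inj_on _ T_inhabited (ltL_seg b).
exists (fun u => match excluded_middle_informative (ltL (proj1_sig u) b) with
  left _ => (t0, c (proj1_sig u)) | right _ => (t1, t0) end).
move=> [x Hx] [y Hy] /=.
case: excluded_middle_informative => xb; case: excluded_middle_informative => yb.
- by move=> [E]; apply: elts_eq; apply: cP.
- by move=> [E]; case: n01.
- by move=> [E]; case: n01.
- move=> _; apply: elts_eq => /=.
  case: (ltL_total x b) => [//|[->|//]].
  by case: (ltL_total y b) => [//|[->|//]].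
Qed.

(** Regularity of $\lambda^+$: without a bound, at most $\lambda$ segments of size at most $\lambda$
    would cover [L]. *)
Lemma L_range_bounded (K : Type) (s : K -> L) :
  inj K T -> exists b, forall k, ltL (s k) b.
Proof.
move=> iK; apply: NNPP => H; apply: (proj2 (proj1 L_succ)).
apply: (union_inj_T K L (fun k a => ~ ltL (s k) a) iK) => [k|b].
  exact: inj_le_segL.
by apply: NNPP => nk; apply: H; exists b => k; apply: NNPP => h; apply: nk; exists k.
Qed.

(** * Towers from decreasing chains *)

Definition decreasing_chain (X : L -> T -> Prop) : Prop :=
  (forall a, unbounded (X a)) /\ (forall a b, ltL a b -> almost_sub T (X b) (X a)).

Lemma chain_tower (X : L -> T -> Prop) :
  decreasing_chain X ->
  ~ (exists C, unbounded C /\ forall a, almost_sub T C (X a)) ->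
  exists F, tower T F /\ is_succ_card T (fam_elts T F).
Proof.
move=> [uX dX] nopi; pose F : family T := fun A => exists a, X a = A.
(* [X] may repeat sets; least indices carry the well-order over to [F]. *)
have [m mP] : exists m : fam_elts T F -> L, forall u,
    X (m u) = proj1_sig u /\ forall a, X a = proj1_sig u -> ~ ltL a (m u).
  apply: (fun_choice (fun u c => X c = proj1_sig u /\ forall a, X a = proj1_sig u -> ~ ltL a c)) => -[A FA] /=.
  exact: (wf_least ltL (fun a => X a = A) (proj1 ltL_wo) FA).
have minj u v : m u = m v -> u = v.
  by move=> E; apply: elts_eq; rewrite -(proj1 (mP u)) -(proj1 (mP v)) E.
have nopiF : ~ has_big_pi T F.
  move=> [C [/big_unbounded uC pC]]; apply: nopi; exists C; split=> // a.
  by apply: pC; exists a.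
(* Otherwise the least indices have a bound [b], and [X b] is a pseudointersection. *)
have nFT : ~ inj (fam_elts T F) T.
  move=> /(L_range_bounded _ m) [b Hb]; apply: nopiF; exists (X b); split.
    exact/big_unbounded.
  move=> A FA; have [E _] := mP (exist _ A FA).
  by rewrite -[A]E; apply/dX/Hb.
exists F; split; last first.
  split; first by split=> //; case: (inj_total T (fam_elts T F)).
  by move=> Y TY; apply: (inj_trans _ (proj2 L_succ Y TY)); exists m.
split; first by move=> A [a <-]; apply/big_unbounded.
split.
  exists (fun u v => ltL (m u) (m v)); split; [|split; [|split]].
  - by apply: wf_inverse_image; case: ltL_wo.
  - by move=> a b c; apply: ltL_trans.
  - by move=> a b; case: (ltL_total (m a) (m b)) => [|[/minj|]]; tauto.
  - by move=> a b /dX; rewrite (proj1 (mP a)) (proj1 (mP b)).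
split=> // F' F'F _ [iF' nF'].
have [b Hb] := L_range_bounded _ (fun u : fam_elts T F' =>
  m (exist _ (proj1_sig u) (F'F _ (proj2_sig u)))) iF'.
apply/big_unbounded => c.
have [|x [[_ h] cx]] := almost_sub_big_inter (fam_elts T F') (X b)
  (@proj1_sig _ _) nF' (uX b) _ c.
  by move=> u; have /dX := Hb u; rewrite (proj1 (mP _)).
by exists x; split=> // A F'A; apply: (h (exist _ A F'A)).
Qed.

(** * Chains whose gaps dominate given functions *)

Definition thin (f : T -> T) (X : T -> Prop) : Prop :=
  forall x y, X x -> X y -> lt x y -> lt (f x) y.

(** Without a maximum, [A] contains an increasing sequence, hence a copy of [nat] and so of [T]. *)
Lemma countable_small_max (A : L -> Prop) :
  inj T nat -> ~ inj T (elts L A) -> (exists k, A k) ->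
  exists k, A k /\ forall a, A a -> a = k \/ ltL a k.
Proof.
move=> Tnat nA [a0 Aa0]; apply: NNPP => H; apply: nA; apply: (inj_trans Tnat).
have [n nP] : exists n : elts L A -> elts L A, forall u, ltL (proj1_sig u) (proj1_sig (n u)).
  apply: (fun_choice (fun u v => ltL (proj1_sig u) (proj1_sig v))) => -[k Ak]; apply: NNPP => nk; apply: H; exists k; split=> // a Aa.
  case: (ltL_total a k) => [|[|ka]]; [by right|by left|].
  by case: nk; exists (exist _ a Aa).
pose s := fix s i := match i with O => exist _ a0 Aa0 | S j => n (s j) end.
have sS i j : Peano.lt i j -> ltL (proj1_sig (s i)) (proj1_sig (s j)).
  by elim=> [|j' _ IH]; [exact: nP|apply: (ltL_trans _ _ _ IH); exact: nP].
exists s => i j E; case: (PeanoNat.Nat.lt_trichotomy i j) => [/sS|[//|/sS]];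
  by rewrite E => /ltL_irrefl.
Qed.

(** The coding [e] exhausts the segment below [b] by small sets increasing with [c]. *)
Lemma small_initial (b : L) (e : L -> T) (c : T) :
  (forall x y, ltL x b -> ltL y b -> e x = e y -> x = y) ->
  ~ inj T (elts L (fun a => ltL a b /\ ~ lt c (e a))).
Proof.
move=> einj h; apply: (small_le_seg c); apply: (inj_trans h).
exists (fun u => exist _ (e (proj1_sig u)) (proj2 (proj2_sig u))).
move=> [x [xb Hx]] [y [yb Hy]] [] /= E; apply: elts_eq; exact: einj.
Qed.

(* In the countable case [X b] is chosen by recursion on [b], a pseudointersection
   existing because a finite subset of [L] has a maximum. *)
Lemma thin_chain_countable (f : L -> T -> T) :
  inj T nat ->
  exists X, decreasing_chain X /\ forall a, thin (f a) (X a).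
Proof.
move=> Tnat; have [wfL _] := ltL_wo; have [wfT _] := lt_wo.
have [t0] := T_inhabited.
have [|X [XP Xr]] := wf_rec_choice ltL (fun _ => True)
  (fun a Y => unbounded Y /\ thin (f a) Y) (fun Y Z => almost_sub T Z Y) wfL ltL_trans.
  move=> b g gP gr.
  have [e einj] := inj_on _ T_inhabited (ltL_seg b).
  (* Only finitely many [g a] are intersected; the one of largest index is almost contained in the
     others. *)
  have inter c : unbounded (fun x => forall a, ltL a b -> ~ lt c (e a) -> g a x).
    case: (classic (exists a, ltL a b /\ ~ lt c (e a))) => [|nk]; last first.
      move=> d; have [x dx] := lt_succ d; exists x; split=> // a ab ca.
      by case: nk; exists a.
    move=> /(countable_small_max _ Tnat (small_initial b e c einj)) [k [[kb _] kmax]] d.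
    have [|x [[_ h] dx]] := almost_sub_big_inter _ (g k)
       (fun u => g (proj1_sig u)) (small_initial b e c einj) (proj1 (gP k kb)) _ d.
      move=> [a [ab ca]] /=; case: (kmax a (conj ab ca)) => [->|ak].
        by apply/almost_subE; exists d.
      exact: gr.
    by exists x; split=> // a ab ca; apply: (h (exist _ a (conj ab ca))).
  (* A diagonal sequence: [h c] lies in the sets of code at most [c], beyond all earlier [h a] and
     [f b (h a)]. Its range is the new set. *)
  have [|h [hP hr]] := wf_rec_choice lt t0
    (fun c x => forall a, ltL a b -> ~ lt c (e a) -> g a x)
    (fun x y => lt (f b x) y /\ lt x y) wfT lt_trans.
    move=> c h _ _.
    have [d1 H1] := small_range_bounded _ (fun u : elts T (fun a => lt a c) => f b (h (proj1_sig u))) (lt_seg c).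
    have [d2 H2] := small_range_bounded _ (fun u : elts T (fun a => lt a c) => h (proj1_sig u)) (lt_seg c).
    have [d [d1d d2d]] := lt_max d1 d2.
    have [x [Hx dx]] := inter c d; exists x; split=> // a ac; split.
      apply: (lt_trans _ _ _ (H1 (exist _ a ac))); exact: (lt_trans _ d).
    apply: (lt_trans _ _ _ (H2 (exist _ a ac))); exact: (lt_trans _ d).
  exists (fun x => exists c, h c = x); split; first split.
  - apply/big_unbounded; exists (fun c => exist _ (h c) (ex_intro _ c erefl)).
    move=> c d [] E.
    case: (lt_total c d) => [/hr [_]|[//|/hr [_]]]; by rewrite E => /lt_irrefl.
  - move=> _ _ [c <-] [d <-] cd.
    case: (lt_total c d) => [/hr [] //|[E|/hr [_ dc]]].
      by subst d; case: (lt_irrefl _ cd).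
    by case: (lt_irrefl _ (lt_trans _ _ _ cd dc)).
  - move=> a ab; apply/almost_subE.
    have [d Hd] := small_range_bounded _ (fun u : elts T (fun c => lt c (e a)) => h (proj1_sig u)) (lt_seg (e a)).
    exists d => _ [c <-] dc; apply: hP => // ca.
    exact: (lt_irrefl _ (lt_trans _ _ _ dc (Hd (exist _ c ca)))).
by exists X; split; [split=> // a|move=> a]; case: (XP a).
Qed.

(** A function bounding [h] on initial segments is iterated from [b]; as [T] is uncountable and
    regular, the sequence has a bound. *)
Lemma closure_points_unbounded (h : T -> T) :
  ~ inj T nat -> unbounded (fun d => forall x, lt x d -> lt (h x) d).
Proof.
move=> nT b.
have [n nP] : exists n : T -> T, forall y, lt y (n y) /\ forall x, ~ lt y x -> lt (h x) (n y).
  apply: (fun_choice (fun y z => lt y z /\ forall x, ~ lt y x -> lt (h x) z)) => y.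
  have [c Hc] := small_range_bounded _ (fun u : elts T (fun x => ~ lt y x) => h (proj1_sig u)) (small_le_seg y).
  have [d [cd yd]] := lt_max c y; exists d; split=> // x yx.
  exact: (lt_trans _ _ _ (Hc (exist _ x yx))).
pose s := fix s i := match i with O => b | S j => n (s j) end.
(* By minimality of [d], any [x] below it is at most some [s i], so [h x] is below [s (S i)]. *)
have [d [Hd dmin]] := wf_least lt (fun d => forall i, lt (s i) d) (proj1 lt_wo)
  (small_range_bounded nat s nT).
exists d; split; last exact: (Hd O).
move=> x xd; apply: NNPP => hx; apply: (dmin x _ xd) => i; apply: NNPP => ix; apply: hx.
apply: (lt_trans _ (s (S i))) => //; exact: (proj2 (nP (s i))).
Qed.

(* In the uncountable case the closure points of an increasing family of functions
   dominating [f] work; unlike for [omega], they are unbounded. *)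
Lemma thin_chain_uncountable (f : L -> T -> T) :
  ~ inj T nat ->
  exists X, decreasing_chain X /\ forall a, thin (f a) (X a).
Proof.
move=> nT; have [wfL _] := ltL_wo.
have [|g [gP gr]] := wf_rec_choice ltL (fun x => x)
  (fun a (h : T -> T) => forall x, ~ lt (h x) (f a x))
  (fun h h' : T -> T => exists c, forall x, lt c x -> ~ lt (h' x) (h x)) wfL ltL_trans.
  move=> b g _ _.
  have [e einj] := inj_on _ T_inhabited (ltL_seg b).
  (* Only the small set of [a] with [e a] at most [x] matters at [x]; thus [y] dominates each [g a]
     beyond [e a]. *)
  have [y yP] : exists y : T -> T, forall x, lt (f b x) (y x) /\
      forall a, ltL a b -> ~ lt x (e a) -> lt (g a x) (y x).
    apply: (fun_choice (fun x z => lt (f b x) z /\ forall a, ltL a b -> ~ lt x (e a) -> lt (g a x) z)) => x.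
    have [c Hc] := small_range_bounded _
      (fun u : elts L (fun a => ltL a b /\ ~ lt x (e a)) => g (proj1_sig u) x)
      (small_initial b e x einj).
    have [d [cd fd]] := lt_max c (f b x); exists d; split=> // a ab xa.
    exact: (lt_trans _ _ _ (Hc (exist _ a (conj ab xa)))).
  have asym x x' : lt x x' -> ~ lt x' x by move=> h h'; apply: (lt_irrefl x); apply: (lt_trans _ x').
  exists y; split=> [x|a ab]; first by apply: asym; case: (yP x).
  exists (e a) => x ax; apply/asym/(proj2 (yP x)) => //; exact: asym.
exists (fun a d => forall x, lt x d -> lt (g a x) d); split; first split.
- by move=> a; apply: closure_points_unbounded.
(* Beyond [c], closure under [g b] gives closure under [g a]; the values of [g a] up to [c] are
   below [d]. *)
- move=> a b /gr [c Hc]; apply/almost_subE.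
  have [d Hd] := small_range_bounded _ (fun u : elts T (fun x => ~ lt c x) => g a (proj1_sig u)) (small_le_seg c).
  exists d => z Hz dz x xz; case: (classic (lt c x)) => [cx|ncx].
    exact: (le_lt_trans _ _ _ (Hc x cx) (Hz x xz)).
  exact: (lt_trans _ _ _ (Hd (exist _ x ncx))).
- move=> a x y _ Hy xy; apply: (le_lt_trans _ (g a x)) => //; exact: Hy.
Qed.

(** * Coherent small sets and the refining chain *)

(** By recursion, [s b c] consists of [b] and the [s a c] for [a] below [b] of code at most [c];
    this is a small union of small sets, and it contains [s a c] once [c] passes the code of [a]. *)
Lemma coherent_small_sets :
  exists s : L -> T -> L -> Prop,
    (forall a c, s a c a) /\ (forall a c, ~ inj T (elts L (s a c))) /\
    forall a b, ltL a b -> exists d, forall c, lt d c -> forall k, s a c k -> s b c k.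
Proof.
have [wfL _] := ltL_wo.
have [|s [sP sr]] := wf_rec_choice ltL (fun _ _ => True)
  (fun a (s : T -> L -> Prop) => forall c, s c a /\ ~ inj T (elts L (s c)))
  (fun s s' => exists d, forall c, lt d c -> forall k, s c k -> s' c k) wfL ltL_trans.
  move=> b s sP _.
  have [e einj] := inj_on _ T_inhabited (ltL_seg b).
  exists (fun c k => k = b \/ exists u : elts L (fun a => ltL a b /\ ~ lt c (e a)), s (proj1_sig u) c k).
  split=> [c|a ab]; first split.
  - by left.
  - apply: small_or; first exact: small_singleton.
    apply: small_union; first exact: small_initial.
    by move=> [a [ab ca]]; case: (sP a ab c).
  - exists (e a) => c ac k sk; right.
    have ca : ~ lt c (e a) by move=> h; apply: (lt_irrefl c); apply: (lt_trans _ (e a)).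
    by exists (exist _ a (conj ab ca)).
by exists s; split=> [a c|]; [case: (sP a c)|split=> // a c; case: (sP a c)].
Qed.

Lemma chain_of_family (A : L -> T -> Prop) :
  (forall S : L -> Prop, ~ inj T (elts L S) -> (exists k, S k) ->
     unbounded (fun x => forall k, S k -> A k x)) ->
  ~ (exists C, unbounded C /\ forall k, almost_sub T C (A k)) ->
  exists X, decreasing_chain X /\
    ~ (exists C, unbounded C /\ forall a, almost_sub T C (X a)).
Proof.
move=> sip nopi.
have [s [sdiag [ssmall smono]]] := coherent_small_sets.
pose R a c x := ~ lt x c /\ forall k, s a c k -> A k x.
have [f fP] : exists f : L -> T -> T, forall a c, R a c (f a c).
  apply: (fun_choice (fun a h => forall c, R a c (h c))) => a.
  apply: (fun_choice (R a)) => c.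
  have [|x [Hx cx]] := sip (s a c) (ssmall a c) _ c; first by exists a.
  exists x; split=> // xc; exact: (lt_irrefl _ (lt_trans _ _ _ xc cx)).
have [X [Xdec Xthin]] : exists X, decreasing_chain X /\ forall a, thin (f a) (X a).
  case: (classic (inj T nat)); [exact: thin_chain_countable|exact: thin_chain_uncountable].
case: (classic (exists C, unbounded C /\ forall a, almost_sub T C (X a))); last by exists X.
move=> [C [uC CX]].
pose Y a x := exists c, C c /\ ~ lt x c /\ (forall d, C d -> lt c d -> lt x d) /\
  forall k, s a c k -> A k x.
have YA a x : Y a x -> A a x by move=> [c [_ [_ [_ h]]]]; apply: h.
exists Y; split; last first.
  move=> [D [uD DY]]; apply: nopi; exists D; split=> // a.
  have /almost_subE [b Hb] := DY a; apply/almost_subE; exists b => x Dx bx.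
  exact/YA/Hb.
split=> [a b|a b /smono [d Hd]].
  (* Beyond [d], [C] lies in the thin set [X a], so [f a c] precedes all later points of [C] and
     belongs to [Y a]. *)
  have /almost_subE [d Hd] := CX a.
  have [m [bm dm]] := lt_max b d.
  have [c [Cc mc]] := uC m; have [fc1 fc2] := fP a c.
  exists (f a c); split; last first.
    by apply: (lt_le_trans _ c) => //; apply: (lt_trans _ m).
  exists c; split=> //; split=> //; split=> // d' Cd' cd'.
  have dc : lt d c by apply: (lt_trans _ m).
  apply: (Xthin a) => //; apply: Hd => //; exact: (lt_trans _ c).
(* A point of [Y b] past [d'] comes from some [c] not before [d'], where [s a c] is contained in
   [s b c]. *)
have [d' [Cd' dd']] := uC d; apply/almost_subE; exists d'.
move=> x [c [Cc [cx [nc sc]]]] d'x.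
have cd' : ~ lt c d' by move=> /(nc d' Cd') h; apply: (lt_irrefl x); apply: (lt_trans _ d').
exists c; do ! split=> //; move=> k sk; apply: sc; apply: Hd => //.
exact: (lt_le_trans _ d').
Qed.

End RegularCardinal.

Theorem mainTheorem1 (T : Type) :
  infinite_card T -> lt_power_eq T -> p_eq_succ T -> t_eq_succ T.
Proof.
move=> inf pow [pmin [F [[Fbig [Fsip Fnopi]] Fsucc]]]; split.
  (* A tower is in particular a [p_family], so the lower bound carries over. *)
  by move=> G [Gbig [_ [Gsip Gnopi]]]; apply: pmin; split.
have [lt [ltwo ltseg]] := strict_wo_short_segments T (fun Y => ~ inj T Y)
  (fun Y Z YZ nZ TY => nZ (inj_trans TY YZ)) (fun Y => NNPP _).
(* A type that does not inject into [T] is larger than [T], so [F], of successor size, injects into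
   it. *)
have [ltL [ltLwo ltLseg]] := strict_wo_short_segments (fam_elts T F) (fun Y => inj Y T)
  (fun Y Z => inj_trans) (fun Y nYT => proj2 Fsucc Y
     (conj (match inj_total T Y with or_introl h => h | or_intror h => False_ind _ (nYT h) end) nYT)).
have [||X [Xdec Xnopi]] := chain_of_family T inf pow lt ltwo ltseg _ ltL ltLwo ltLseg
  (@proj1_sig _ _).
- move=> S nS [k Sk]; apply/(big_unbounded T inf pow lt ltwo ltseg).
  pose F' B := exists H : F B, S (exist _ B H).
  have [|||i iinj] := Fsip F'.
  + by move=> B [].
  + by exists (proj1_sig k); case: k Sk => B FB SB /=; exists FB.
  + apply: (not_inj_lt_card T) => h; apply: nS; apply: (inj_trans h).
    have [g gP] : exists g : fam_elts T F' -> elts _ S, forall u,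
        proj1_sig (proj1_sig (g u)) = proj1_sig u.
      by apply: (fun_choice (fun u v => proj1_sig (proj1_sig v) = proj1_sig u)) => -[B [FB SB]]; exists (exist _ (exist _ B FB) SB).
    by exists g => u v E; apply: elts_eq; rewrite -gP -(gP v) E.
  + apply: (inj_trans (ex_intro _ i iinj)); apply: inj_elts_sub => x Hx [B FB] SB.
    by apply: Hx; exists FB.
- move=> [C [uC CF]]; apply: Fnopi; exists C; split.
    exact/(big_unbounded T inf pow lt ltwo ltseg).
  by move=> B FB; apply: (CF (exist _ B FB)).
- exact: (chain_tower T inf pow lt ltwo ltseg _ Fsucc ltL ltLwo ltLseg X Xdec).
Qed.
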